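(* Let $K,L,\mathsf p\ge1$ be integers, $A\in\mathbb R^{K^{\mathsf p}\times L}$, and $\mathsf H(q)=(AA^\intercal)\cdot q^{\otimes\mathsf p}$ for $q\in\mathbf S^K_+$. Let $f:[0,\infty)\times\mathbf S^K_+\to\mathbb R$ be nondecreasing, Lipschitz, convex, and have nondecreasing gradients. Suppose that $\psi=f(0,\cdot)$ is $C^1$ and that $f$ satisfies $\partial_tf-\mathsf H(\nabla f)=0$ on a dense subset. Then $f$ is a viscosity solution to $$\partial_t f-\mathsf H(\nabla f)=0\quad\text{in }[0,\infty)\times\mathbf S^K_+$$ with initial condition $\psi$.
   Context: $\mathbf S^K$, $\mathbf S^K_+$, $\mathbf S^K_{++}$ denote the sets of real $K\times K$ symmetric, symmetric positive semi-definite, and symmetric positive definite matrices. The dot product is the entry-wise inner product and $|\cdot|$ the associated norm; $\mathbf S^K$ is a Euclidean space with this inner product, and $\mathbb R\times\mathbf S^K$ carries the product inner product. $q^{\otimes\mathsf p}$ is the $\mathsf p$-fold tensor (Kronecker) product, a $K^{\mathsf p}\times K^{\mathsf p}$ matrix. $\partial_t$ and $\nabla$ (with values in $\mathbf S^K$) are the derivatives in the first and second variables. A function on $\mathbf S^K_+$ is $C^1$ if it is differentiable (relative to $\mathbf S^K_+$, including at boundary points) with continuous gradient. $\|f\|_{\mathrm{Lip}}$ is the Lipschitz constant of $f$. Orders. $h_1\le h_2$ in $\mathbf S^K$ means $h_2-h_1\in\mathbf S^K_+$; $(t_1,h_1)\le(t_2,h_2)$ in $\mathbb R\times\mathbf S^K$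 means $t_1\le t_2$ and $h_1\le h_2$. A real-valued function $g$ on $[0,\infty)\times\mathbf S^K_+$ is nondecreasing if $g(y_1)\le g(y_2)$ whenever $y_1\le y_2$. A Lipschitz function $f:[0,\infty)\times\mathbf S^K_+\to\mathbb R$ has nondecreasing gradients if $(\partial_t,\nabla)f(t_1,x_1)\le(\partial_t,\nabla)f(t_2,x_2)$ for all points of differentiability $(t_1,x_1)\le(t_2,x_2)$ of $f$. ''$f$ satisfies $\partial_tf-\mathsf H(\nabla f)=0$ on a dense subset'' means that the set of $(t,x)\in(0,\infty)\times\mathbf S^K_{++}$ at which $f$ is differentiable and $(\partial_tf-\mathsf H(\nabla f))(t,x)=0$ is dense in $[0,\infty)\times\mathbf S^K_+$. Viscosity solutions. Let $f:[0,\infty)\times\mathbf S^K_+\to\mathbb R$ be nondecreasing and Lipschitz. (1) $f$ is a viscosity subsolution if for every $(t,h)\in(0,\infty)\times\mathbf S^K_+$ and every smooth $\phi:(0,\infty)\times\mathbf S^K_+\to\mathbb R$ such that $f-\phi$ has a local maximum at $(t,h)$: $(\partial_t\phi-\mathsf H(\nabla\phi))(t,h)\le0$ if $h\in\mathbf S^K_{++}$, and $\nabla\phi(t,h)\in\mathbf S^K_+$ if $h\in\mathbf S^K_+\setminus\mathbf S^K_{++}$. (2) $f$ is a viscosity supersolution if for every $(t,h)\in(0,\infty)\times\mathbf S^K_+$ and every smooth $\phi:(0,\infty)\times\mathbf S^K_+\to\mathbb R$ such that $f-\phi$ has a local minimum at $(t,h)$: $(\partial_t\phi-\mathsf H(\nabla\phi))(t,h)\ge0$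 if $h\in\mathbf S^K_{++}$, and $\partial_t\phi(t,h)-\inf\mathsf H(q)\ge0$ if $h\in\mathbf S^K_+\setminus\mathbf S^K_{++}$, where the infimum is over all $q\in(\nabla\phi(t,h)+\mathbf S^K_+)\cap\mathbf S^K_+$ with $|q|\le\|f\|_{\mathrm{Lip}}$ (the infimum over the empty set being $+\infty$). (3) $f$ is a viscosity solution if it is both a viscosity subsolution and a viscosity supersolution. *)

(* Defs.v *)
From HB Require Import structures.
From mathcomp Require Import all_boot all_order all_algebra.
From mathcomp Require Import all_classical all_reals all_analysis.
From mathcomp.real_closed Require mxtens.

Set Implicit Arguments.
Unset Strict Implicit.
Unset Printing Implicit Defensive.

Import Order.TTheory GRing.Theory Num.Theory.
Import numFieldNormedType.Exports.

Local Open Scope classical_set_scope.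
Local Open Scope ring_scope.

(* S^K is represented inside 'M[R]_K, and a function on [0, +oo) x S^K_+ by a
   total function on R * 'M[R]_K whose values off the domain are never used.
   The topology is that of the library, which all norms induce; the Lipschitz
   constant and the bound |q| <= ||f||_Lip use the Euclidean norms below. *)

Section SymmetricMatrices.
Variables (R : realType) (K : nat).

Definition symmx : set 'M[R]_K := [set h | h^T = h].

Definition psdmx : set 'M[R]_K :=
  [set h | symmx h /\ forall u : 'cV[R]_K, 0 <= (u^T *m h *m u) 0 0].

Definition pdmx : set 'M[R]_K :=
  [set h | symmx h /\ forall u : 'cV[R]_K, u != 0 -> 0 < (u^T *m h *m u) 0 0].

Definition lemx (h1 h2 : 'M[R]_K) : Prop := psdmx (h2 - h1).

Definition lepair (y1 y2 : R * 'M[R]_K) : Prop :=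
  y1.1 <= y2.1 /\ lemx y1.2 y2.2.

Definition sympair : set (R * 'M[R]_K) := [set y | symmx y.2].

Definition dom : set (R * 'M[R]_K) := [set y | 0 <= y.1 /\ psdmx y.2].

Definition dom_pos : set (R * 'M[R]_K) := [set y | 0 < y.1 /\ psdmx y.2].

Definition dom_int : set (R * 'M[R]_K) := [set y | 0 < y.1 /\ pdmx y.2].

End SymmetricMatrices.

Section InnerProducts.
Variable R : realType.

Definition mxdot m n (a b : 'M[R]_(m, n)) : R := \sum_i \sum_j a i j * b i j.

Definition mxnorm2 m n (a : 'M[R]_(m, n)) : R := Num.sqrt (mxdot a a).

Definition pairdot K (x y : R * 'M[R]_K) : R := x.1 * y.1 + mxdot x.2 y.2.

Definition pairnorm2 K (x : R * 'M[R]_K) : R := Num.sqrt (pairdot x x).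

End InnerProducts.

(* Calculus relative to a subset D of the linear subspace S of V, for the inner
   product ip.  The gradient is sought in S; it is unique as soon as D is
   convex with nonempty interior relative to S, which holds for S^K_+ in S^K
   and for the domains above in R x S^K. *)
Section RelativeCalculus.
Variables (R : realType) (V : normedModType R).
Variables (ip : V -> V -> R) (S D : set V).

Definition is_gradient (f : V -> R) (x g : V) : Prop :=
  S g /\ forall e : R, 0 < e ->
    \forall y \near within D (nbhs x),
      `|f y - f x - ip g (y - x)| <= e * `|y - x|.

(* Differentiability at boundary points of D is relative to D.  By Whitney's
   extension theorem, on the domains above [smooth] characterizes the
   restrictions of C^oo functions defined around D. *)
Fixpoint Ck (k : nat) (f : V -> R) : Prop :=
  if k is k'.+1 then
    exists2 g : V -> V, (forall x, D x -> is_gradient f x (g x))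
                      & forall v, Ck k' (fun x => ip (g x) v)
  else {within D, continuous f}.

Definition smooth (f : V -> R) : Prop := forall k, Ck k f.

End RelativeCalculus.

Section FunctionsOnTheDomain.
Variables (R : realType) (K : nat).
Implicit Types (f phi : R * 'M[R]_K -> R) (psi : 'M[R]_K -> R).

Definition C1_psd psi : Prop :=
  Ck (@mxdot R K K) (@symmx R K) (@psdmx R K) 1 psi.

(* In this gradient, g.1 is the time derivative and g.2 the gradient in S^K. *)
Definition gradient_dom f (y g : R * 'M[R]_K) : Prop :=
  is_gradient (@pairdot R K) (@sympair R K) (@dom R K) f y g.

Definition gradient_test phi (y g : R * 'M[R]_K) : Prop :=
  is_gradient (@pairdot R K) (@sympair R K) (@dom_pos R K) phi y g.

Definition smooth_test phi : Prop :=
  smooth (@pairdot R K) (@sympair R K) (@dom_pos R K) phi.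

Definition nondecreasing_dom f : Prop :=
  forall y1 y2, dom y1 -> dom y2 -> lepair y1 y2 -> f y1 <= f y2.

Definition lipschitz_dom f : Prop :=
  exists M : R, forall y1 y2, dom y1 -> dom y2 ->
    `|f y1 - f y2| <= M * pairnorm2 (y1 - y2).

Definition lip_const f : R :=
  sup [set r | exists y1 y2, [/\ dom y1, dom y2, y1 != y2 &
                                 r = `|f y1 - f y2| / pairnorm2 (y1 - y2)]].

Definition convex_dom f : Prop :=
  convex_function (@dom R K : set (convex_lmodType (R * 'M[R]_K)%type)) f.

Definition nondecreasing_gradients f : Prop :=
  forall y1 y2 g1 g2, dom y1 -> dom y2 -> lepair y1 y2 ->
    gradient_dom f y1 g1 -> gradient_dom f y2 g2 -> lepair g1 g2.

End FunctionsOnTheDomain.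

Definition nonlinearity (R : realType) (K L p : nat) (A : 'M[R]_(K ^ p, L))
    (q : 'M[R]_K) : R :=
  mxdot (A *m A^T) (mxtens.ntensmx q p).

Section ViscositySolutions.
Variables (R : realType) (K : nat) (H : 'M[R]_K -> R).
Implicit Types (f phi : R * 'M[R]_K -> R).

Definition satisfies_on_dense_subset f : Prop :=
  @dom R K `<=` closure [set y | dom_int y /\
    exists g, gradient_dom f y g /\ g.1 - H g.2 = 0].

Definition has_local_max (F : R * 'M[R]_K -> R) (y : R * 'M[R]_K) : Prop :=
  \forall z \near within (@dom_pos R K) (nbhs y), F z <= F y.

Definition has_local_min (F : R * 'M[R]_K -> R) (y : R * 'M[R]_K) : Prop :=
  \forall z \near within (@dom_pos R K) (nbhs y), F y <= F z.

Definition viscosity_subsolution f : Prop :=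
  [/\ nondecreasing_dom f, lipschitz_dom f &
   forall y phi g, dom_pos y -> smooth_test phi ->
    has_local_max (f \- phi) y -> gradient_test phi y g ->
    (pdmx y.2 -> g.1 - H g.2 <= 0) /\ (~ pdmx y.2 -> psdmx g.2)].

Definition viscosity_supersolution f : Prop :=
  [/\ nondecreasing_dom f, lipschitz_dom f &
   forall y phi g, dom_pos y -> smooth_test phi ->
    has_local_min (f \- phi) y -> gradient_test phi y g ->
    (pdmx y.2 -> 0 <= g.1 - H g.2) /\
    (~ pdmx y.2 ->
      (0 <= g.1%:E - ereal_inf [set (H q)%:E | q in
        [set q | [/\ lemx g.2 q, psdmx q & (mxnorm2 q <= lip_const f)%R]]])%E)].

Definition viscosity_solution f : Prop :=
  viscosity_subsolution f /\ viscosity_supersolution f.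

Definition initial_condition f (psi : 'M[R]_K -> R) : Prop :=
  forall h, psdmx h -> f (0, h) = psi h.

End ViscositySolutions.

(* Main.v *)
(* A local minimum of f - phi at (t, h) makes (b, P) = (d_t phi, grad phi) a
   subgradient of the convex function f at (t, h).  If the minimum of psi - P .
   over S^K_+ is attained at x0, then q = grad psi(x0) satisfies q >= P and
   (q - P) . x0 = 0.  Since psi is C^1, the gradients of f at nearby points of
   the dense set, where d_t f = H(grad f), converge to (H(q), q), which is
   therefore a subgradient of f at (0, x0).  Adding the two subgradient
   inequalities between (t, h) and (0, x0) gives H(q) <= b.  This q is a
   competitor in the boundary condition; in the interior P is positive
   semi-definite, and H(P) <= H(q) because H is nondecreasing on S^K_+.
   Attainment is forced by tilting P to P - d I and letting d tend to 0.
   A local maximum of f - phi at an interior point makes f differentiable there,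
   with gradient the limit of the gradients at the points of the dense set. *)
Require Import Defs.
From mathcomp Require Import all_boot all_order all_algebra.
From mathcomp Require Import all_classical all_reals all_analysis.
From mathcomp.real_closed Require Import mxtens.
From mathcomp Require Import ring lra.

Set Implicit Arguments.
Unset Strict Implicit.
Unset Printing Implicit Defensive.

Import Order.TTheory GRing.Theory Num.Theory.
Import numFieldNormedType.Exports.

Local Open Scope classical_set_scope.
Local Open Scope ring_scope.

(** * Positive semi-definite matrices *)

Section InnerProduct.
Variable R : realType.

Lemma mxdot_tr m n (a b : 'M[R]_(m, n)) : mxdot a b = \tr (a^T *m b).
Proof.
rewrite /mxdot /mxtrace exchange_big; apply: eq_bigr => j _.
by rewrite mxE; apply: eq_bigr => i _; rewrite mxE.
Qed.

Lemma mxdotC m n (a b : 'M[R]_(m, n)) : mxdot a b = mxdot b a.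
Proof. by apply: eq_bigr => i _; apply: eq_bigr => j _; rewrite mulrC. Qed.

Lemma mxdotDr m n (c a b : 'M[R]_(m, n)) :
  mxdot c (a + b) = mxdot c a + mxdot c b.
Proof. by rewrite !mxdot_tr mulmxDr raddfD. Qed.

Lemma mxdotZr m n k (c a : 'M[R]_(m, n)) : mxdot c (k *: a) = k * mxdot c a.
Proof. by rewrite !mxdot_tr -scalemxAr mxtraceZ. Qed.

Lemma mxdotNr m n (c a : 'M[R]_(m, n)) : mxdot c (- a) = - mxdot c a.
Proof. by rewrite -scaleN1r mxdotZr mulN1r. Qed.

Lemma mxdotDl m n (c a b : 'M[R]_(m, n)) :
  mxdot (a + b) c = mxdot a c + mxdot b c.
Proof. by rewrite mxdotC mxdotDr !(mxdotC c). Qed.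

Lemma mxdotZl m n k (c a : 'M[R]_(m, n)) : mxdot (k *: a) c = k * mxdot a c.
Proof. by rewrite mxdotC mxdotZr mxdotC. Qed.

Lemma mxdotNl m n (c a : 'M[R]_(m, n)) : mxdot (- a) c = - mxdot a c.
Proof. by rewrite mxdotC mxdotNr mxdotC. Qed.

Lemma mxdot_scalar n (c : R) (a : 'M[R]_n) : mxdot c%:M a = c * \tr a.
Proof. by rewrite mxdot_tr tr_scalar_mx mul_scalar_mx mxtraceZ. Qed.

Lemma mxdot_ge0 m n (a : 'M[R]_(m, n)) : 0 <= mxdot a a.
Proof.
apply: sumr_ge0 => i _; apply: sumr_ge0 => j _.
by rewrite -expr2 sqr_ge0.
Qed.

(** The quadratic form is linear in the matrix, so sums, multiples and limits of forms reduce to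
    those of [mxdot]. *)
Lemma quad_mxdot n (h : 'M[R]_n) (u : 'cV[R]_n) :
  (u^T *m h *m u) 0 0 = mxdot (u *m u^T) h.
Proof.
by rewrite mxdot_tr trmx_mul trmxK -[in RHS]mulmxA mxtrace_mulC [RHS]big_ord1.
Qed.

Lemma quad_scalar n (c : R) (u : 'cV[R]_n) :
  (u^T *m c%:M *m u) 0 0 = c * (u^T *m u) 0 0.
Proof. by rewrite mul_mx_scalar -scalemxAl mxE. Qed.

Lemma entry_mxdot m n (a : 'M[R]_(m, n)) i j : mxdot a (delta_mx i j) = a i j.
Proof.
rewrite /mxdot (bigD1 i) //= (bigD1 j) //= big1 => [|k kj]; last first.
  by rewrite mxE eqxx (negPf kj) mulr0.
rewrite addr0 big1 ?addr0 => [|k ki]; first by rewrite mxE !eqxx mulr1.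
by apply: big1 => l _; rewrite mxE (negPf ki) mulr0.
Qed.

Lemma entry_le_norm2 m n (a : 'M[R]_(m, n)) i j : `|a i j| <= mxnorm2 a.
Proof.
rewrite -sqrtr_sqr ler_wsqrtr // /mxdot (bigD1 i) //= (bigD1 j) //=.
rewrite expr2 -addrA.
rewrite lerDl addr_ge0 ?sumr_ge0 // => k _; first by rewrite -expr2 sqr_ge0.
by apply: sumr_ge0 => l _; rewrite -expr2 sqr_ge0.
Qed.

End InnerProduct.

Section PositiveMatrices.
Variable R : realType.
Implicit Types K : nat.

Lemma psdD K (x y : 'M[R]_K) : psdmx x -> psdmx y -> psdmx (x + y).
Proof.
move=> [xs xp] [ys yp]; split; first by rewrite /symmx /= raddfD /= xs ys.
by move=> u; rewrite quad_mxdot mxdotDr -!quad_mxdot addr_ge0.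
Qed.

Lemma psdZ K (c : R) (x : 'M[R]_K) : 0 <= c -> psdmx x -> psdmx (c *: x).
Proof.
move=> c0 [xs xp]; split; first by rewrite /symmx /= linearZ /= xs.
by move=> u; rewrite quad_mxdot mxdotZr -!quad_mxdot mulr_ge0.
Qed.

Lemma psd_gram K m (B : 'M[R]_(K, m)) : psdmx (B *m B^T).
Proof.
split; first by rewrite /symmx /= trmx_mul trmxK.
move=> u; set v := B^T *m u.
have -> : u^T *m (B *m B^T) *m u = v^T *m v.
  by rewrite /v trmx_mul trmxK !mulmxA.
rewrite mxE; apply: sumr_ge0 => i _.
by rewrite mxE -expr2 sqr_ge0.
Qed.

Lemma psd0 K : psdmx (0 : 'M[R]_K).
Proof. by have := psd_gram (0 : 'M[R]_K); rewrite mul0mx. Qed.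

Lemma psd_scalar K (c : R) : 0 <= c -> psdmx (c%:M : 'M[R]_K).
Proof.
move=> c0; rewrite -scalemx1; apply: psdZ => //.
by have := psd_gram (1%:M : 'M[R]_K); rewrite trmx1 mulmx1.
Qed.

Lemma quad_delta K (x : 'M[R]_K) i j :
  ((delta_mx i 0 : 'cV[R]_K)^T *m x *m (delta_mx j 0 : 'cV[R]_K)) 0 0 = x i j.
Proof. by rewrite trmx_delta -rowE -colE !mxE. Qed.

Lemma psd_diag_ge0 K (x : 'M[R]_K) i : psdmx x -> 0 <= x i i.
Proof. by case=> _ /(_ (delta_mx i 0)); rewrite quad_delta. Qed.

Lemma bilin_tr K (x : 'M[R]_K) (u v : 'cV[R]_K) : symmx x ->
  (u^T *m x *m v) 0 0 = (v^T *m x *m u) 0 0.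
Proof.
move=> xs; rewrite -[in LHS](trmxK (u^T *m x *m v)) mxE.
by rewrite !trmx_mul trmxK xs !mulmxA.
Qed.

Lemma quad_comb K (x : 'M[R]_K) (u v : 'cV[R]_K) (s : R) : symmx x ->
  ((u + s *: v)^T *m x *m (u + s *: v)) 0 0 =
  (u^T *m x *m u) 0 0 + 2 * s * (v^T *m x *m u) 0 0
    + s ^+ 2 * (v^T *m x *m v) 0 0.
Proof.
move=> xs; have E := bilin_tr u v xs.
have -> : (u + s *: v)^T = u^T + s *: v^T by rewrite raddfD /= linearZ.
rewrite !mulmxDl !mulmxDr -!scalemxAl -!scalemxAr.
rewrite [LHS]mxE [X in X + _]mxE [X in _ + X]mxE [X in _ + X + _]mxE.
rewrite E [X in _ + (X + _)]mxE [X in _ + (_ + X)]mxE.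
rewrite [X in _ + (_ + _ * X)]mxE; ring.
Qed.

Lemma psd_entry_bound K (x : 'M[R]_K) i j (s : R) : psdmx x ->
  0 <= x j j + 2 * s * x i j + s ^+ 2 * x i i.
Proof.
case=> xs xp; have := xp (delta_mx j 0 + s *: delta_mx i 0).
by rewrite quad_comb // !quad_delta.
Qed.

Lemma psd_zero_diag K (x : 'M[R]_K) i j : psdmx x -> x i i = 0 -> x i j = 0.
Proof.
move=> xp xii; apply/eqP/negPn/negP => x0.
(* With [x i i = 0] the bound is affine in [s]; this [s] makes it equal to -1. *)
have := psd_entry_bound i j (- (x j j + 1) / (2 * x i j)) xp.
rewrite xii mulr0 addr0.
suff -> : 2 * (- (x j j + 1) / (2 * x i j)) * x i j = - (x j j + 1) by lra.
by field.
Qed.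

(* One step of Gaussian elimination: it kills the i-th diagonal entry and
   preserves the vanishing ones. *)
Lemma psd_eliminate K (x : 'M[R]_K) i : psdmx x -> x i i != 0 ->
  psdmx (x - (x i i)^-1 *: (col i x *m (col i x)^T)).
Proof.
move=> xp xi; have [xs xq] := xp.
split.
  by rewrite /symmx /= raddfB /= linearZ /= trmx_mul trmxK xs.
move=> u; set c := col i x; set e : 'cV[R]_K := delta_mx i 0.
pose a := (e^T *m x *m u) 0 0.
have cu : (c^T *m u) 0 0 = a by rewrite /a /c colE trmx_mul xs.
have uc : (u^T *m c) 0 0 = a.
  by rewrite /a (bilin_tr _ _ xs) /c colE mulmxA.
(* The shift along [e] minimises the form on the line through [u], and the minimum is the form of
   the eliminated matrix at [u]. *)
have := xq (u + (- (a / x i i)) *: e).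
rewrite quad_comb // quad_delta -/a => H.
rewrite quad_mxdot mxdotDr mxdotNr mxdotZr -!quad_mxdot.
have -> : (u^T *m (c *m c^T) *m u) 0 0 = a ^+ 2.
  rewrite mulmxA -mulmxA mxE big_ord1 uc cu expr2 //.
suff <- : (u^T *m x *m u) 0 0 + 2 * - (a / x i i) * a +
    (- (a / x i i)) ^+ 2 * x i i =
  (u^T *m x *m u) 0 0 - (x i i)^-1 * a ^+ 2 by [].
by field.
Qed.

(** Induction on the number of nonzero diagonal entries: each elimination step adds one column to
    [B], and a zero diagonal forces [x = 0]. *)
Lemma psd_gramP K (x : 'M[R]_K) : psdmx x ->
  exists m (B : 'M[R]_(K, m)), x = B *m B^T.
Proof.
have [n] := ubnP #|[set i | x i i != 0]%SET|.
elim: n x => // n IH x; rewrite ltnS => xn xp.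
have [x0|[i xi]] : (forall i, x i i = 0) \/ exists i, x i i != 0.
  have [/existsP h|/existsPn h] := boolP [exists i, x i i != 0]; first by right.
  by left=> i; apply/eqP/negPn/h.
  exists 0%N, 0; rewrite mul0mx; apply/matrixP => i j.
  by rewrite mxE (psd_zero_diag _ xp).
set x' := x - (x i i)^-1 *: (col i x *m (col i x)^T).
have xii : 0 < x i i by rewrite lt_def xi psd_diag_ge0.
have [||m [B xB]] := IH x'; last 1 first.
- exists (m + 1)%N, (row_mx B (Num.sqrt (x i i)^-1 *: col i x)).
  rewrite tr_row_mx mul_row_col -xB linearZ /= -scalemxAl -scalemxAr scalerA.
  by rewrite -expr2 sqr_sqrtr ?invr_ge0 ?ltW // /x' subrK.
- apply: leq_trans xn; apply: proper_card; apply/properP; split.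
    apply/fintype.subsetP => j; rewrite !inE; apply: contraNneq => xj.
    rewrite !mxE big_ord1 !mxE xj [x j i](psd_zero_diag _ xp xj).
    by rewrite mul0r mulr0 subr0.
  exists i; rewrite !inE //= !mxE big_ord1 !mxE mulrA mulVf ?mul1r ?subrr //.
  by rewrite eqxx.
- exact: psd_eliminate.
Qed.

Lemma psd_congr K m (B : 'M[R]_(K, m)) (x : 'M[R]_K) :
  psdmx x -> psdmx (B^T *m x *m B).
Proof.
move=> /psd_gramP[n [C ->]].
by have := psd_gram (B^T *m C); rewrite trmx_mul trmxK !mulmxA.
Qed.

Lemma psd_trace_ge0 K (x : 'M[R]_K) : psdmx x -> 0 <= \tr x.
Proof. by move=> xp; apply: sumr_ge0 => i _; exact: psd_diag_ge0. Qed.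

(** Half of the self-duality of the cone: a Gram factor of [x] turns the product into the trace of a
    congruence of [y]. *)
Lemma psd_mxdot_ge0 K (x y : 'M[R]_K) : psdmx x -> psdmx y -> 0 <= mxdot x y.
Proof.
move=> /psd_gramP[n [B ->]] yp; rewrite mxdot_tr trmx_mul trmxK -mulmxA.
by rewrite mxtrace_mulC; exact/psd_trace_ge0/psd_congr.
Qed.

(** The converse half of self-duality; the rank-one matrices [u *m u^T] suffice as test matrices. *)
Lemma psd_of_mxdot K (x : 'M[R]_K) : symmx x ->
  (forall y, psdmx y -> 0 <= mxdot x y) -> psdmx x.
Proof.
move=> xs xy; split=> // u; rewrite quad_mxdot mxdotC.
exact/xy/psd_gram.
Qed.

Lemma psd_tens K M (x : 'M[R]_K) (y : 'M[R]_M) :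
  psdmx x -> psdmx y -> psdmx (x *t y).
Proof.
move=> /psd_gramP[n [B ->]] /psd_gramP[m [C ->]].
by rewrite -tensmx_mul -trmx_tens; exact: psd_gram.
Qed.

Lemma psd_le K (x y : 'M[R]_K) : psdmx x -> lemx x y -> psdmx y.
Proof. by move=> xp xy; have := psdD xy xp; rewrite subrK. Qed.

Lemma lemx_tens K M (x x' : 'M[R]_K) (y y' : 'M[R]_M) :
  psdmx x -> psdmx y' -> lemx x x' -> lemx y y' ->
  lemx (x *t y) (x' *t y').
Proof.
move=> xp yp xx yy; rewrite /lemx.
suff -> : x' *t y' - x *t y = (x' - x) *t y' + x *t (y' - y).
  by apply: psdD; exact: psd_tens.
by apply/matrixP => i j; rewrite !mxE; ring.
Qed.

(** [ntensmx_rec x n] is the tensor power of order [n.+1], so the induction starts at [x] itself. *)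
Lemma psd_ntens K (x : 'M[R]_K) n : psdmx x -> psdmx (ntensmx_rec x n).
Proof. by move=> xp; elim: n => //= n IH; exact: (@psd_tens K (K ^ n.+1)). Qed.

Lemma lemx_ntens K (x y : 'M[R]_K) n : psdmx x -> lemx x y ->
  lemx (ntensmx_rec x n) (ntensmx_rec y n).
Proof.
move=> xp xy; elim: n => //= n IH.
apply: (@lemx_tens K (K ^ n.+1)) => //; exact/psd_ntens/(psd_le xp).
Qed.

(** The increment of the tensor power is positive semi-definite, hence pairs nonnegatively with
    [A *m A^T]. *)
Lemma nonlinearity_mono K L p (A : 'M[R]_(K ^ p, L)) (x y : 'M[R]_K) :
  (0 < p)%N -> psdmx x -> lemx x y -> nonlinearity A x <= nonlinearity A y.
Proof.
case: p A => // p A _ xp xy; rewrite -subr_ge0 /nonlinearity -mxdotNr -mxdotDr.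
apply: psd_mxdot_ge0; first exact: psd_gram.
exact: lemx_ntens.
Qed.

(** Each product of two coordinates of [u] is at most the mean of their squares; summing over all
    pairs produces the factor [K]. *)
Lemma quad_norm_bound K (m : 'M[R]_K) (u : 'cV[R]_K) (d : R) :
  (forall i j, `|m i j| <= d) ->
  `|(u^T *m m *m u) 0 0| <= d * K%:R * (u^T *m u) 0 0.
Proof.
move=> md; rewrite quad_mxdot.
have -> : (u^T *m u) 0 0 = \sum_i (u i 0) ^+ 2.
  by rewrite mxE; apply: eq_bigr => i _; rewrite mxE expr2.
apply: le_trans (ler_norm_sum _ _ _) _.
have -> : d * K%:R * \sum_i u i 0 ^+ 2 =
  \sum_(i < K) \sum_(j < K) d * ((u i 0 ^+ 2 + u j 0 ^+ 2) / 2).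
  transitivity (\sum_(i < K) (d / 2 * (K%:R * u i 0 ^+ 2) +
      d / 2 * \sum_(j < K) u j 0 ^+ 2)).
    rewrite big_split /= -!mulr_sumr sumr_const card_ord -mulr_natl.
    by field.
  apply: eq_bigr => i _; rewrite -!mulr_sumr -mulr_suml big_split /=.
  rewrite sumr_const card_ord -mulr_natl.
  by ring.
apply: ler_sum => i _; apply: le_trans (ler_norm_sum _ _ _) _.
apply: ler_sum => j _; rewrite mxE big_ord1 mxE normrM mulrC.
apply: ler_pM => //.
rewrite normrM -(real_normK (num_real (u i 0))).
rewrite -(real_normK (num_real (u j 0))).
have := sqr_ge0 (`|u i 0| - `|u j 0|); nra.
Qed.

Lemma psd_perturb K (m : 'M[R]_K) (d : R) : symmx m ->
  (forall i j, `|m i j| <= d) -> psdmx ((d * K%:R)%:M + m).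
Proof.
move=> ms md; split; first by rewrite /symmx /= raddfD /= tr_scalar_mx ms.
move=> u; have := quad_norm_bound u md.
rewrite (quad_mxdot (_ + _)) mxdotDr -!quad_mxdot quad_scalar.
by rewrite ler_norml => /andP[+ _]; lra.
Qed.

Lemma pd_psd K (x : 'M[R]_K) : pdmx x -> psdmx x.
Proof.
move=> [xs xp]; split=> // u; have [->|/xp/ltW//] := eqVneq u 0.
by rewrite mulmx0 mxE.
Qed.

(* With [y = x^-1], expanding [(u - s y u)^T x (u - s y u) >= 0] gives
   [u^T x u >= 2 s |u|^2 - s^2 u^T y u], to be used with a small [s]. *)
Lemma pd_lemx_scalar K (x : 'M[R]_K) : pdmx x ->
  exists2 c : R, 0 < c & lemx c%:M x.
Proof.
move=> xpd; have xpsd := pd_psd xpd; case: (xpd) => xs xp.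
have ux : x \in unitmx.
  rewrite -row_free_unit -kermx_eq0; apply/eqP/row_matrixP => i.
  rewrite row0; apply/eqP/negPn/negP => r0.
  have := xp (row i (kermx x))^T.
  rewrite -trmx0 (inj_eq trmx_inj) r0 => /(_ isT).
  by rewrite trmxK -row_mul mulmx_ker row0 mul0mx mxE ltxx.
pose y := invmx x.
have ys : symmx y by rewrite /symmx /= trmx_inv xs.
pose D : R := 1 + \sum_i \sum_j `|y i j|.
have D1 : 1 <= D by rewrite lerDl; apply: sumr_ge0 => i _; apply: sumr_ge0.
have yD i j : `|y i j| <= D.
  rewrite /D (bigD1 i) //= (bigD1 j) //=.
  rewrite addrCA -!addrA lerDl !addr_ge0 ?sumr_ge0 // => k _.
  by apply: sumr_ge0.
(* Since [y] has form at most [D * K] times |u|^2, this choice gives s^2 u^T y u <= s |u|^2. The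
   added 1 keeps the inverse meaningful when [K = 0]. *)
pose s := (D * (K%:R + 1))^-1.
have K0 : 0 <= K%:R :> R by [].
have s0 : 0 < s by rewrite invr_gt0 mulr_gt0; lra.
exists s => //; split.
  by rewrite /symmx /= raddfB /= tr_scalar_mx xs.
move=> u; have := quad_norm_bound u yD.
rewrite (quad_mxdot (_ - _)) mxdotDr mxdotNr -!quad_mxdot quad_scalar.
case: xpsd => _ /(_ (u + (- s) *: (y *m u))); rewrite quad_comb //.
have -> : (y *m u)^T *m x *m u = u^T *m u.
  by rewrite trmx_mul ys -[_ *m y *m x]mulmxA mulVmx // mulmx1.
have -> : (y *m u)^T *m x *m (y *m u) = u^T *m y *m u.
  by rewrite trmx_mul ys -[_ *m y *m x]mulmxA mulVmx // mulmx1 mulmxA.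
have u0 : 0 <= (u^T *m u) 0 0.
  by rewrite mxE; apply: sumr_ge0 => i _; rewrite mxE -expr2 sqr_ge0.
move: ((u^T *m y *m u) 0 0) ((u^T *m u) 0 0) u0 ((u^T *m x *m u) 0 0).
move=> a n n0 b H /(le_trans (ler_norm _)) an.
have sD : s * (D * K%:R) <= 1.
  rewrite /s mulrC ler_pdivrMr; last by rewrite mulr_gt0; lra.
  by rewrite mul1r ler_pM2l; lra.
suff : s ^+ 2 * a <= s * n by nra.
rewrite expr2 -mulrA ler_pM2l //.
apply: le_trans (_ : s * (D * K%:R * n) <= _); first by rewrite ler_pM2l.
by rewrite mulrA -[leRHS]mul1r ler_wpM2r.
Qed.

(** The test vectors e_j + e_i and e_j - e_i bound twice the entry by the sum of two diagonal
    entries. A bound on the trace thus gives compactness. *)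
Lemma psd_entry_trace K (x : 'M[R]_K) i j : psdmx x -> `|x i j| <= \tr x.
Proof.
move=> xp; have t k : x k k <= \tr x.
  rewrite /mxtrace (bigD1 k) //= lerDl; apply: sumr_ge0 => l _.
  exact: psd_diag_ge0.
have := psd_entry_bound i j 1 xp; have := psd_entry_bound i j (- 1) xp.
have := t i; have := t j; rewrite ler_norml => *; apply/andP; split; lra.
Qed.

End PositiveMatrices.

(** * Entrywise limits *)

Section EntrywiseLimits.
Context {R : realType} {T : Type} {F : set_system T} {FF : ProperFilter F}.

(** The filter is arbitrary because limits are taken both along sequences and along ultrafilters. *)
Definition mxcvg m n (u : T -> 'M[R]_(m, n)) (l : 'M[R]_(m, n)) : Prop :=
  forall i j, u t i j @[t --> F] --> l i j.

Definition paircvg K (y : T -> R * 'M[R]_K) (l : R * 'M[R]_K) : Prop :=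
  (y t).1 @[t --> F] --> l.1 /\ mxcvg (fun t => (y t).2) l.2.

Lemma cvg_sumr n (u : 'I_n -> T -> R) (l : 'I_n -> R) :
  (forall i, u i t @[t --> F] --> l i) ->
  \sum_i u i t @[t --> F] --> \sum_i l i.
Proof. by move=> ul; apply: cvg_big => // x; exact: add_continuous. Qed.

Lemma cvg_sqrt (u : T -> R) (l : R) :
  u t @[t --> F] --> l -> Num.sqrt (u t) @[t --> F] --> Num.sqrt l.
Proof.
by move=> ul; apply: (continuous_cvg _ _ ul); exact: sqrt_continuous.
Qed.

Lemma mxcvg_cst m n (l : 'M[R]_(m, n)) : mxcvg (fun=> l) l.
Proof. by move=> i j; exact: cvg_cst. Qed.

Lemma mxcvgD m n (u v : T -> 'M[R]_(m, n)) l k :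
  mxcvg u l -> mxcvg v k -> mxcvg (fun t => u t + v t) (l + k).
Proof.
move=> ul vk i j; rewrite mxE; under eq_cvg do rewrite mxE.
exact: cvgD.
Qed.

Lemma mxcvgB m n (u v : T -> 'M[R]_(m, n)) l k :
  mxcvg u l -> mxcvg v k -> mxcvg (fun t => u t - v t) (l - k).
Proof.
move=> ul vk; apply: mxcvgD => // i j; rewrite mxE.
by under eq_cvg do rewrite mxE; exact: cvgN.
Qed.

Lemma mxcvg_dot m n (u v : T -> 'M[R]_(m, n)) l k :
  mxcvg u l -> mxcvg v k -> mxdot (u t) (v t) @[t --> F] --> mxdot l k.
Proof.
by move=> ul vk; apply: cvg_sumr => i; apply: cvg_sumr => j; exact: cvgM.
Qed.

Lemma mxcvg_ntens K (u : T -> 'M[R]_K) l n : mxcvg u l ->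
  mxcvg (fun t => ntensmx_rec (u t) n) (ntensmx_rec l n).
Proof.
move=> ul; elim: n => //= n IH i j; rewrite mxE.
by under eq_cvg do rewrite mxE; apply: cvgM; [exact: ul|exact: IH].
Qed.

Lemma mxcvg_nonlinearity K L p (A : 'M[R]_(K ^ p, L)) (u : T -> 'M[R]_K) l :
  (0 < p)%N -> mxcvg u l ->
  nonlinearity A (u t) @[t --> F] --> nonlinearity A l.
Proof.
case: p A => // p A _ ul; apply: mxcvg_dot; first exact: mxcvg_cst.
exact: mxcvg_ntens.
Qed.

Lemma mxcvg_psd K (u : T -> 'M[R]_K) l :
  mxcvg u l -> (forall t, psdmx (u t)) -> psdmx l.
Proof.
move=> ul up; split.
  apply/matrixP => i j; rewrite mxE.
  have e : (fun t => u t j i) = (fun t => u t i j).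
    by apply/funext => t; case: (up t) => us _; rewrite -[in LHS]us mxE.
  have := ul j i; rewrite e => uji.
  by apply: (cvg_unique _ uji) => //; exact: ul.
move=> w; rewrite quad_mxdot.
have wl : mxdot (w *m w^T) (u t) @[t --> F] --> mxdot (w *m w^T) l.
  by apply: mxcvg_dot => //; exact: mxcvg_cst.
by apply: (cvgr_to_ge wl); apply: nearW => t; rewrite -quad_mxdot; case: (up t).
Qed.

Lemma mxcvg_norm2_le m n (u : T -> 'M[R]_(m, n)) l c :
  mxcvg u l -> (forall t, mxnorm2 (u t) <= c) -> mxnorm2 l <= c.
Proof.
move=> ul uc; have ulc : mxnorm2 (u t) @[t --> F] --> mxnorm2 l.
  by apply: cvg_sqrt; exact: mxcvg_dot.
by apply: (cvgr_to_le ulc); exact: nearW.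
Qed.

Lemma paircvg_dot K (y z : T -> R * 'M[R]_K) l k : paircvg y l -> paircvg z k ->
  pairdot (y t) (z t) @[t --> F] --> pairdot l k.
Proof.
move=> [yl1 yl2] [zk1 zk2]; apply: cvgD; first exact: cvgM.
exact: mxcvg_dot.
Qed.

Lemma paircvg_cst K (l : R * 'M[R]_K) : paircvg (fun=> l) l.
Proof. by split; [exact: cvg_cst|exact: mxcvg_cst]. Qed.

Lemma paircvgB K (y z : T -> R * 'M[R]_K) l k : paircvg y l -> paircvg z k ->
  paircvg (fun t => y t - z t) (l - k).
Proof. by move=> [? ?] [? ?]; split; [exact: cvgB|exact: mxcvgB]. Qed.

Lemma paircvgDr K (y : T -> R * 'M[R]_K) l k : paircvg y l ->
  paircvg (fun t => y t + k) (l + k).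
Proof.
move=> [? ?]; split; first by apply: cvgD => //; exact: cvg_cst.
by apply: mxcvgD => //; exact: mxcvg_cst.
Qed.

Lemma lipschitz_cvg K (f : R * 'M[R]_K -> R) (y : T -> R * 'M[R]_K) l :
  lipschitz_dom f -> (\forall t \near F, dom (y t)) -> dom l ->
  paircvg y l -> f (y t) @[t --> F] --> f l.
Proof.
move=> [M fM] yd ld yl.
have M0 : M * pairnorm2 (y t - l) @[t --> F] --> 0.
  rewrite -(mulr0 M); apply: cvgMl_tmp.
  have -> : 0 = pairnorm2 (l - l).
    rewrite /pairnorm2 subrr /pairdot mul0r add0r /mxdot.
    rewrite big1 ?sqrtr0 // => i _; rewrite big1 // => j _.
    by rewrite mxE mul0r.
  apply: cvg_sqrt; apply: paircvg_dot; apply: paircvgB => //.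
    exact: paircvg_cst.
  exact: paircvg_cst.
apply/cvgrPdist_le => e e0.
move/cvgrPdist_le : M0 => /(_ e e0); apply: filterS2 yd => t /= td.
rewrite sub0r normrN => h; rewrite distrC.
exact: le_trans (fM _ _ td ld) (le_trans (ler_norm _) h).
Qed.

(** The room [c] between [y.2] and the boundary of the cone absorbs both the distance from [u t] to
    [y] and the displacement along [v]. In time, either [y.1] leaves room or [v] does not move. *)
Lemma dom_perturb K (u : T -> R * 'M[R]_K) y v (c : R) :
  (forall t, dom (u t)) -> paircvg u y -> sympair v -> 0 < c ->
  lemx c%:M y.2 -> 0 < y.1 \/ v.1 = 0 ->
  \forall s \near 0^'+, \forall t \near F, dom (u t + s *: v).
Proof.
move=> ud [uy1 uy2] vs c0 cy tv.
pose B := mxnorm2 v.2 + 1.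
have B0 : 0 < B by rewrite ltr_pwDr // sqrtr_ge0.
(* The entries of [(u t).2 - y.2] and of [s *: v.2] are each kept below [D], so their sum lowers the
   form by at most [2 * D * K], which is at most [c]. *)
pose D := c / (2 * (K%:R + 1)).
have K0 : 0 <= K%:R :> R by [].
have D0 : 0 < D by rewrite divr_gt0 // mulr_gt0; lra.
have DK : 2 * D * K%:R <= c.
  have -> : 2 * D * K%:R = c * (K%:R / (K%:R + 1)) by rewrite /D; field; lra.
  rewrite -[leRHS]mulr1 ler_pM2l // ler_pdivrMr; lra.
have uyD : \forall t \near F, forall ij : 'I_K * 'I_K,
    `|(u t).2 ij.1 ij.2 - y.2 ij.1 ij.2| <= D.
  apply: filter_forall => -[i j] /=.
  have /cvgrPdist_le/(_ _ D0) := uy2 i j.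
  by apply: filterS => t; rewrite distrC.
have uyt : 0 < y.1 -> \forall t \near F, y.1 / 2 <= (u t).1.
  move=> y0; apply: (cvgr_ge y.1) => //; lra.
have small : \forall s \near 0^'+, 0 < y.1 -> s * `|v.1| <= y.1 / 2.
  have [y0|_] := ltP 0 y.1; last exact: nearW.
  have vp : 0 < `|v.1| + 1 by rewrite ltr_wpDl.
  near=> s => _; apply: (@le_trans _ _ (s * (`|v.1| + 1))).
    by rewrite ler_wpM2l ?lerDl //; near: s; exact: nbhs_right_ge.
  rewrite -ler_pdivlMr //; near: s; apply: nbhs_right_ltW.
  by rewrite divr_gt0 // divr_gt0.
near=> s.
have s0 : 0 < s by near: s; exact: nbhs_right_gt.
have sB : s * B <= D.
  rewrite -ler_pdivlMr //; near: s; apply: nbhs_right_ltW.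
  by rewrite divr_gt0.
have st : 0 < y.1 -> s * `|v.1| <= y.1 / 2 by near: s.
have time : \forall t \near F, 0 <= (u t).1 + s * v.1.
  case: tv => [y0|v0]; last first.
    by apply: nearW => t; rewrite v0 mulr0 addr0; case: (ud t).
  apply: filterS (uyt y0) => t ut.
  have := st y0; have : - (s * `|v.1|) <= s * v.1.
    by rewrite -mulrN ler_pM2l // lerNl -normrN ler_norm.
  lra.
apply: filterS2 time uyD => t t1 t2; split => //=.
have [us _] := (ud t).2.
have [/= cys _] := cy; have ys : symmx y.2.
  move: cys; rewrite /symmx /= raddfB /= tr_scalar_mx; exact: addIr.
have : psdmx ((2 * D * K%:R)%:M + ((u t).2 - y.2 + s *: v.2)).
  apply: psd_perturb.
    by rewrite /symmx /= raddfD raddfB /= linearZ /= us ys vs.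
  move=> i j; rewrite !mxE; apply: le_trans (ler_normD _ _) _.
  have := t2 (i, j) => /= ?.
  suff : `|s * v.2 i j| <= D by lra.
  rewrite normrM gtr0_norm //; apply: le_trans sB; rewrite ler_pM2l //.
  by apply: le_trans (entry_le_norm2 _ _ _) _; rewrite lerDl.
(* The perturbed matrix is the sum of [y.2 - c%:M], the scalar matrix of [c - 2 * D * K%:R], and the
   perturbation compensated by [2 * D * K%:R]. *)
have c2 : 0 <= c - 2 * D * K%:R by lra.
move=> /psdD /(_ (psdD cy (psd_scalar K c2))).
congr (psdmx _); apply/matrixP => i j; rewrite !mxE.
by case: (i == j); rewrite ?mulr1n ?mulr0n /=; ring.
Unshelve. all: by end_near. Qed.

End EntrywiseLimits.

Arguments mxcvg {R T} F {m n} u l.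
Arguments paircvg {R T} F {K} y l.

(** * Compactness through ultrafilters *)

Lemma ultra_bounded_cvg (R : realType) (U : set_system nat)
    (u : nat -> R) (M : R) :
  UltraFilter U -> (forall n, `|u n| <= M) ->
  exists l : R, u n @[n --> U] --> l.
Proof.
move=> UU uM.
have [l [_ ul]] : `[- M, M]%classic `&` cluster (u @ U) !=set0.
  apply: segment_compact.
  by apply: (@nearW _ U) => n /=; rewrite in_itv /= -ler_norml.
(* An ultrafilter contains [B] or its complement, and a cluster point rules out the complement. *)
exists l => B Bl; have [//|UB] := in_ultra_setVsetC (u @^-1` B) UU.
have [x [xB Bx]] : ~` B `&` B !=set0 by apply: ul.
by [].
Qed.

(** One ultrafilter serves all entries at once, in place of successive extractions of
    subsequences. *)
Lemma ultra_mxcvg (R : realType) (U : set_system nat) K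
    (u : nat -> 'M[R]_K) (M : R) :
  UltraFilter U -> (forall n i j, `|u n i j| <= M) -> exists l, mxcvg U u l.
Proof.
move=> UU uM.
have h (ij : 'I_K * 'I_K) : exists l : R, u n ij.1 ij.2 @[n --> U] --> l.
  exact: ultra_bounded_cvg.
have [l ul] := choice h.
by exists (\matrix_(i, j) l (i, j)) => i j; rewrite mxE; exact: (ul (i, j)).
Qed.

(** * Subgradients of convex functions *)

Section Slopes.
Context {R : realType}.

(** First-order comparisons hold up to an error [e * s]; dividing by one small positive [s] and
    letting [e] tend to 0 leaves the slopes. *)
Lemma slope_le (c d : R) :
  (forall e, 0 < e -> \forall s \near 0^'+, s * c <= s * d + e * s) -> c <= d.
Proof.
move=> h; apply/ler_addgt0Pr => e e0.
have [s [/= s0]] : exists s : R, 0 < s /\ s * c <= s * d + e * s.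
  apply: (@filter_ex _ (0 : R)^'+).
  by apply: filterS2 (nbhs_right_gt 0) (h _ e0) => s.
by rewrite [e * s]mulrC -mulrDr ler_pM2l.
Qed.

Lemma near_direction (V : normedModType R) (D : set V) (y v : V)
    (P : V -> Prop) :
  (\forall s \near 0^'+, D (y + s *: v)) ->
  (\forall z \near within D (nbhs y), P z) ->
  \forall s \near 0^'+, P (y + s *: v).
Proof.
move=> Ds; rewrite near_withinE => Pz.
have cv : y + s *: v @[s --> (0 : R)^'+] --> y.
  apply: cvg_at_right_filter.
  rewrite -[X in _ --> X]addr0; apply: cvgD; first exact: cvg_cst.
  rewrite -(scale0r v); apply: cvgZr_tmp; exact: cvg_id.
by apply: filterS2 Ds (cv _ Pz) => s sD; exact.
Qed.

Lemma gradient_direction (V : normedModType R) (ip : V -> V -> R) (S D : set V)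
    (phi : V -> R) (y g v : V) :
  (forall (s : R) w, ip g (s *: w) = s * ip g w) ->
  is_gradient ip S D phi y g ->
  (\forall s \near 0^'+, D (y + s *: v)) ->
  forall e : R, 0 < e -> \forall s \near 0^'+,
    `|phi (y + s *: v) - phi y - s * ip g v| <= e * s.
Proof.
move=> ipZ [_ yg] Ds e e0.
(* The added 1 covers [v = 0]. *)
have v0 : 0 < `|v| + 1 by rewrite ltr_wpDl.
have e'0 : 0 < e / (`|v| + 1) by rewrite divr_gt0.
apply: filterS2 (nbhs_right_gt 0) (near_direction Ds (yg _ e'0)) => s s0.
rewrite [y + _]addrC addrK ipZ => /le_trans; apply.
rewrite normrZ gtr0_norm // mulrCA [e * s]mulrC ler_pM2l //.
by rewrite -[leRHS]mulr1 -mulrA ler_pM2l // mulrC ler_pdivrMr // mul1r lerDl.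
Qed.

End Slopes.

Section Subgradients.
Context {R : realType} {K : nat}.
Implicit Types (f : R * 'M[R]_K -> R) (x y z g v : R * 'M[R]_K).

(** The inequality is asked on [dom] only, so at a boundary point vectors normal to [dom] may be
    added to [g]. *)
Definition subgradient f y g : Prop :=
  forall z, dom z -> f y + pairdot g (z - y) <= f z.

Lemma pairdotZr g (s : R) v : pairdot g (s *: v) = s * pairdot g v.
Proof. by rewrite /pairdot /= mxdotZr mulrDr; congr (_ + _); exact: mulrCA. Qed.

Lemma pathE (V : lmodType R) (a b : V) (s : R) :
  a + s *: (b - a) = (1 - s) *: a + s *: b.
Proof. by rewrite scalerBl scale1r scalerBr [s *: b - _]addrC addrA. Qed.

Lemma pairdotNr g v : pairdot g (- v) = - pairdot g v.
Proof. by rewrite -scaleN1r pairdotZr mulN1r. Qed.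

Lemma convex_dom_path f y z (s : R) : convex_dom f -> dom y -> dom z ->
  0 <= s <= 1 -> f (y + s *: (z - y)) <= f y + s * (f z - f y).
Proof.
move=> fc yd zd /andP[s0 s1].
have h : f (s *: z + (1 - s) *: y) <= s * f z + (1 - s) * f y.
  by apply: (fc (Itv01 s0 s1) z y); rewrite inE.
rewrite pathE addrC; apply: le_trans h _; lra.
Qed.

Lemma dom_path y z (s : R) : dom y -> dom z -> 0 <= s <= 1 ->
  dom (y + s *: (z - y)).
Proof.
move=> [y1 y2] [z1 z2] /andP[s0 s1]; split => /=.
  have -> : y.1 + s * (z.1 - y.1) = (1 - s) * y.1 + s * z.1 by ring.
  by rewrite addr_ge0 // mulr_ge0 // subr_ge0.
by rewrite pathE; apply: psdD; apply: psdZ; rewrite ?subr_ge0.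
Qed.

Lemma near0_unit : \forall s \near (0 : R)^'+, 0 <= s <= 1.
Proof.
apply: filterS2 (nbhs_right_ge 0) (nbhs_right_ltW ltr01) => s /= s0 s1.
by rewrite s0.
Qed.

Lemma dom_direction y v (d : R) : dom y -> sympair v -> 0 < d ->
  lemx d%:M y.2 -> 0 < y.1 \/ v.1 = 0 ->
  \forall s \near 0^'+, dom (y + s *: v).
Proof.
move=> yd vs d0 dy tv.
have FF : ProperFilter (0 : R)^'+ by exact: at_right_proper_filter.
have := @dom_perturb R R _ FF K (fun=> y) y v d (fun=> yd)
  (@paircvg_cst R R _ FF K y) vs d0 dy tv.
by apply: filterS => s /filter_ex[].
Qed.

(** Convexity makes a first-order lower bound global: the quotient along the segment to [z] never
    exceeds [f z - f y]. *)
Lemma convex_subgradient f y g : convex_dom f -> dom y ->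
  (forall z, dom z -> forall e, 0 < e -> \forall s \near 0^'+,
    s * pairdot g (z - y) - e * s <= f (y + s *: (z - y)) - f y) ->
  subgradient f y g.
Proof.
move=> fc yd fg z zd; rewrite addrC -lerBrDr; apply: slope_le => e e0.
apply: filterS2 near0_unit (fg z zd e e0) => s s01 h.
have := convex_dom_path fc yd zd s01; lra.
Qed.

Lemma gradient_subgradient f y g : convex_dom f -> dom y ->
  gradient_dom f y g -> subgradient f y g.
Proof.
move=> fc yd fg; apply: convex_subgradient => // z zd e e0.
have ds : \forall s \near 0^'+, dom (y + s *: (z - y)).
  by apply: filterS near0_unit => s; exact: dom_path.
have := gradient_direction (pairdotZr g) fg ds e0.
by apply: filterS => s; rewrite ler_norml => /andP[+ _]; lra.
Qed.

Lemma test_subgradient f phi y g : convex_dom f -> dom_pos y ->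
  has_local_min (f \- phi) y -> gradient_test phi y g -> subgradient f y g.
Proof.
move=> fc [y1 y2] fphi gphi.
have yd : dom y by split => //; exact: ltW.
apply: convex_subgradient => // z zd e e0.
(* The point [z] may lie at time 0; the segment still has positive times as long as [s < 1]. *)
have ds : \forall s \near 0^'+, dom_pos (y + s *: (z - y)).
  apply: filterS2 near0_unit (nbhs_right_lt ltr01) => s s01 s1.
  have [_ ?] := dom_path yd zd s01; split => //=.
  case: zd => z1 _.
  have -> : y.1 + s * (z.1 - y.1) = (1 - s) * y.1 + s * z.1 by ring.
  case/andP: s01 => s0 _; rewrite ltr_wpDr ?mulr_ge0 // mulr_gt0 //; lra.
have := gradient_direction (pairdotZr g) gphi ds e0.
apply: filterS2 (near_direction ds fphi) => s /=.
by rewrite ler_norml => h /andP[+ _]; lra.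
Qed.

(** * Limits of subgradients *)

Section Limit.
Context {T : Type} {F : set_system T} {FF : ProperFilter F}.

(** The subgradient inequality at [u t] is tested at [u t + s *: v] with [s] fixed; continuity of
    [f] then transfers to [u t] the growth known at [y]. *)
Lemma subgradient_direction f (u g : T -> R * 'M[R]_K) y v (c : R) :
  lipschitz_dom f -> dom y -> (forall t, dom (u t)) -> paircvg F u y ->
  (forall t, subgradient f (u t) (g t)) ->
  (\forall s \near 0^'+, dom (y + s *: v)) ->
  (\forall s \near 0^'+, \forall t \near F, dom (u t + s *: v)) ->
  (forall e, 0 < e ->
    \forall s \near 0^'+, f (y + s *: v) - f y <= s * c + e * s) ->
  forall e, 0 < e -> \forall t \near F, pairdot (g t) v <= c + e.
Proof.
move=> fL yd ud uy ug ydv udv fc e e0.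
(* Half of the error is spent on the choice of [s], the other half on the limit in [t]. *)
have e2 : 0 < e / 2 by rewrite divr_gt0.
have [s [s0 [sy [su sf]]]] : exists s : R, 0 < s /\ dom (y + s *: v) /\
    (\forall t \near F, dom (u t + s *: v)) /\
    f (y + s *: v) - f y <= s * c + e / 2 * s.
  apply: (@filter_ex _ (0 : R)^'+); near=> s; split.
    by near: s; exact: nbhs_right_gt.
  split; first by near: s.
  by split; near: s => //; exact: fc.
have fcv : f (u t + s *: v) - f (u t) @[t --> F] --> f (y + s *: v) - f y.
  apply: cvgB; apply: lipschitz_cvg => //; last exact: nearW.
  exact: paircvgDr.
have : \forall t \near F, f (u t + s *: v) - f (u t) <= s * (c + e).
  apply: (cvgr_le _ fcv); apply: le_lt_trans sf _.
  rewrite mulrDr [e / 2 * s]mulrC ltrD2l ltr_pM2l //; lra.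
apply: filterS2 su => t td h.
rewrite -(ler_pM2l s0); apply: le_trans h.
have := ug t _ td; rewrite [u t + _]addrC addrK pairdotZr; lra.
Unshelve. all: by end_near. Qed.

(** The one-sided bounds along [v] and [- v] squeeze the slopes: a first-order upper bound on a
    convex function in both directions leaves one possible limit. *)
Lemma subgradient_cvg f (u g : T -> R * 'M[R]_K) y v (c : R) (d : R) :
  lipschitz_dom f -> dom y -> (forall t, dom (u t)) -> paircvg F u y ->
  (forall t, subgradient f (u t) (g t)) ->
  sympair v -> 0 < d -> lemx d%:M y.2 -> 0 < y.1 \/ v.1 = 0 ->
  (forall e, 0 < e ->
    \forall s \near 0^'+, f (y + s *: v) - f y <= s * c + e * s) ->
  (forall e, 0 < e ->
    \forall s \near 0^'+, f (y + s *: - v) - f y <= s * - c + e * s) ->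
  pairdot (g t) v @[t --> F] --> c.
Proof.
move=> fL yd ud uy ug vs d0 dy tv fv fNv.
have Nvs : sympair (- v) by rewrite /sympair /= /symmx /= raddfN /= vs.
have Ntv : 0 < y.1 \/ (- v).1 = 0.
  by case: tv => [|/= ->]; [left|right; rewrite oppr0].
apply/cvgrPdist_le => e e0.
have h1 := subgradient_direction fL yd ud uy ug (dom_direction yd vs d0 dy tv)
  (dom_perturb ud uy vs d0 dy tv) fv e0.
have h2 := subgradient_direction fL yd ud uy ug (dom_direction yd Nvs d0 dy Ntv)
  (dom_perturb ud uy Nvs d0 dy Ntv) fNv e0.
apply: filterS2 (h1 FF) (h2 FF) => t; rewrite pairdotNr => a1 a2.
rewrite ler_norml; apply/andP; split; lra.
Qed.

(** Only symmetric directions are available as tests; pairing with a symmetrised elementary matrix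
    recovers an entry. *)
Lemma sym_mxcvg (u : T -> 'M[R]_K) l : symmx l -> (forall t, symmx (u t)) ->
  (forall w, symmx w -> mxdot (u t) w @[t --> F] --> mxdot l w) -> mxcvg F u l.
Proof.
move=> ls us ul i j.
pose w : 'M[R]_K := 2^-1 *: (delta_mx i j + delta_mx j i).
have ws : symmx w.
  by rewrite /symmx /= linearZ /= raddfD /= !trmx_delta addrC.
have wE (x : 'M[R]_K) : symmx x -> mxdot x w = x i j.
  move=> xs; rewrite mxdotZr mxdotDr !entry_mxdot.
  have -> : x j i = x i j by rewrite -[in LHS]xs mxE.
  by field.
rewrite -wE //; have -> : (fun t => u t i j) = (fun t => mxdot (u t) w).
  by apply/funext => t; rewrite wE.
exact: ul.
Qed.

Lemma subgradient_lim f (u g : T -> R * 'M[R]_K) y h :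
  lipschitz_dom f -> dom y -> (forall t, dom (u t)) ->
  paircvg F u y -> paircvg F g h ->
  (forall t, subgradient f (u t) (g t)) -> subgradient f y h.
Proof.
move=> fL yd ud uy gh ug z zd.
have fu : f (u t) @[t --> F] --> f y.
  by apply: lipschitz_cvg => //; exact: nearW.
have gu : pairdot (g t) (z - u t) @[t --> F] --> pairdot h (z - y).
  by apply: paircvg_dot => //; apply: paircvgB => //; exact: paircvg_cst.
apply: (cvgr_to_le (cvgD fu gu)); apply: nearW => t; exact: ug.
Qed.

End Limit.
End Subgradients.

(** * The convex selection argument *)

Lemma cvg_inv_succ (R : realType) (u : nat -> R) (l : R) :
  (forall n, `|l - u n| <= n.+1%:R^-1) -> u n @[n --> \oo] --> l.
Proof.
move=> ul; apply/cvgrPdist_le => e e0.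
apply: filterS (near_infty_natSinv_lt (PosNum e0)) => n /= ne.
exact: le_trans (ul n) (ltW ne).
Qed.

Section LipschitzConstant.
Context {R : realType} {K : nat}.
Variables (f : R * 'M[R]_K -> R).
Hypothesis fL : lipschitz_dom f.

(** The Lipschitz hypothesis bounds the set of quotients above, so [sup] is a true supremum and not
    a default value. *)
Lemma lip_constP y1 y2 : dom y1 -> dom y2 ->
  `|f y1 - f y2| <= lip_const f * pairnorm2 (y1 - y2).
Proof.
move=> d1 d2; have [M fM] := fL.
have [n0|n0] := eqVneq (pairnorm2 (y1 - y2)) 0.
  by have := fM _ _ d1 d2; rewrite n0 !mulr0.
have npos : 0 < pairnorm2 (y1 - y2) by rewrite lt_def n0 sqrtr_ge0.
rewrite -ler_pdivrMr //; apply: ub_le_sup.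
  exists `|M| => _ [z1 [z2 [e1 e2 _ ->]]].
  have [-> |m0] := eqVneq (pairnorm2 (z1 - z2)) 0; first by rewrite invr0 mulr0.
  rewrite ler_pdivrMr ?lt_def ?m0 ?sqrtr_ge0 //.
  by apply: le_trans (fM _ _ e1 e2) _; rewrite ler_wpM2r ?sqrtr_ge0 ?ler_norm.
exists y1, y2; split => //; apply: contraNneq n0 => ->.
rewrite /pairnorm2 /pairdot subrr mxdot_tr trmx0 mul0mx mxtrace0.
by rewrite mul0r addr0 sqrtr0.
Qed.

Lemma lip_const_ge0 : 0 <= lip_const f.
Proof.
have d0 : dom (0 : R, 0 : 'M[R]_K) by split; [|exact: psd0].
have d1 : dom (1 : R, 0 : 'M[R]_K) by split; [|exact: psd0].
have := lip_constP d1 d0.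
rewrite /pairnorm2 /pairdot /= !subr0 mulr1 mxdot_tr trmx0 mul0mx mxtrace0.
by rewrite addr0 sqrtr1 mulr1; apply: le_trans.
Qed.

End LipschitzConstant.

Section ConvexSelection.
Context {R : realType} {K L p : nat}.
Variables (A : 'M[R]_(K ^ p, L)) (f : R * 'M[R]_K -> R) (psi : 'M[R]_K -> R).
Hypothesis p_gt0 : (0 < p)%N.
Hypothesis f_nondecreasing : nondecreasing_dom f.
Hypothesis f_lipschitz : lipschitz_dom f.
Hypothesis f_convex : convex_dom f.
Hypothesis f_psi : initial_condition f psi.
Hypothesis f_eq : satisfies_on_dense_subset (nonlinearity A) f.
Variable G : 'M[R]_K -> 'M[R]_K.
Hypothesis psi_gradient : forall x, psdmx x ->
  is_gradient (@mxdot R K K) (@symmx R K) (@psdmx R K) psi x (G x).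
Hypothesis G_continuous : forall v,
  {within @psdmx R K, continuous (fun x => mxdot (G x) v)}.

Let H := nonlinearity A.

(** A point of the dense set is chosen in each ball of radius [n.+1%:R^-1]; by convexity its
    gradient is a global subgradient. *)
Lemma dense_sequence y : dom y -> exists u g : nat -> R * 'M[R]_K,
  [/\ forall n, dom (u n), paircvg \oo u y, forall n, subgradient f (u n) (g n),
      forall n, sympair (g n) & forall n, (g n).1 = H (g n).2].
Proof.
move=> yd.
have h (n : nat) : exists zg : (R * 'M[R]_K) * (R * 'M[R]_K),
    [/\ dom zg.1, ball y n.+1%:R^-1 zg.1, gradient_dom f zg.1 zg.2 &
        zg.2.1 = H zg.2.2].
  have [|z [[[z1 z2] [g [fg gH]]] yz]] := f_eq yd (B := ball y n.+1%:R^-1).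
    by apply: nbhsx_ballx; rewrite invr_gt0.
  exists (z, g); split => //=; last by apply/eqP; rewrite -subr_eq0 gH.
  by split; [exact: ltW|exact: pd_psd].
have [zg zgP] := choice h.
exists (fun n => (zg n).1), (fun n => (zg n).2); split.
- by move=> n; have [] := zgP n.
- split; first by apply: cvg_inv_succ => n; have [_ [/ltW]] := zgP n.
  move=> i j; apply: cvg_inv_succ => n.
  by have [_ [_ [_ /(_ i j)/ltW]]] := zgP n.
- by move=> n; have [zd _ fg _] := zgP n; exact: gradient_subgradient.
- by move=> n; have [_ _ []] := zgP n.
- by move=> n; have [] := zgP n.
Qed.

Lemma pairdot_time (x : R * 'M[R]_K) : pairdot x (1, 0) = x.1.
Proof.
by rewrite /pairdot mulr1 mxdotC mxdot_tr trmx0 mul0mx mxtrace0 addr0.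
Qed.

Lemma pairdot_space (x : R * 'M[R]_K) w : pairdot x (0, w) = mxdot x.2 w.
Proof. by rewrite /pairdot mulr0 add0r. Qed.

(** Touching from above bounds the growth of [f] along [v] and [- v] by the slope of [phi]. The
    gradients at the dense points therefore converge to [g], and the equation passes to the
    limit. *)
Lemma interior_touched_above phi y g : dom_pos y -> pdmx y.2 ->
  has_local_max (f \- phi) y -> gradient_test phi y g -> g.1 = H g.2.
Proof.
move=> [y1 y2] ypd fphi gphi.
have yd : dom y by split => //; exact: ltW.
have [d d0 dy] := pd_lemx_scalar ypd.
have [u [q [ud uy uq qs qH]]] := dense_sequence yd.
have touch v : sympair v -> forall e, 0 < e ->
    \forall s \near 0^'+, f (y + s *: v) - f y <= s * pairdot g v + e * s.
  move=> vs e e0.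
  have dp : \forall s \near 0^'+, dom_pos (y + s *: v).
    have cv : y.1 + s * v.1 @[s --> (0 : R)^'+] --> y.1.
      rewrite -[X in _ --> X]addr0; apply: cvgD; first exact: cvg_cst.
      rewrite -[X in _ --> X](mul0r v.1); apply: cvgMr_tmp.
      by apply: cvg_at_right_filter; exact: cvg_id.
    apply: filterS2 (cvgr_gt _ cv _ y1)
      (dom_direction yd vs d0 dy (or_introl y1)).
    by move=> s sy [_ ?]; split.
  have := gradient_direction (pairdotZr g) gphi dp e0.
  apply: filterS2 (near_direction dp fphi) => s /=.
  by rewrite ler_norml => ? /andP[_]; lra.
have qg v : sympair v -> pairdot (q n) v @[n --> \oo] --> pairdot g v.
  move=> vs.
  apply: (subgradient_cvg f_lipschitz yd ud uy uq vs d0 dy (or_introl y1)).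
    exact: touch.
  move=> e e0; rewrite -pairdotNr; apply: touch => //.
  by rewrite /sympair /= /symmx /= raddfN /= vs.
have qg1 : (q n).1 @[n --> \oo] --> g.1.
  have := qg (1, 0) (trmx0 _ _ _).
  by rewrite pairdot_time; under eq_cvg do rewrite pairdot_time.
have qg2 : mxcvg \oo (fun n => (q n).2) g.2.
  apply: sym_mxcvg; [by case: gphi|exact: qs|move=> w ws].
  have := qg (0, w) ws.
  by rewrite pairdot_space; under eq_cvg do rewrite pairdot_space.
have qg1' : (q n).1 @[n --> \oo] --> H g.2.
  by under eq_cvg do rewrite qH; exact: mxcvg_nonlinearity.
by apply: (cvg_unique _ qg1) => //.
Qed.

(** * The gradient of the initial condition *)

Lemma initial_direction x w : psdmx x ->
  (\forall s \near 0^'+, psdmx (x + s *: w)) ->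
  forall e, 0 < e -> \forall s \near 0^'+,
    `|f (0, x + s *: w) - f (0, x) - s * mxdot (G x) w| <= e * s.
Proof.
move=> xp xw e e0.
have := gradient_direction (fun s v => mxdotZr s (G x) v)
  (psi_gradient xp) xw e0.
by apply: filterS2 xw => s sp; rewrite !f_psi.
Qed.

Lemma psd_ray (x w : 'M[R]_K) : psdmx x -> psdmx w ->
  \forall s \near 0^'+, psdmx (x + s *: w).
Proof.
move=> xp wp; apply: filterS (nbhs_right_ge 0) => s s0.
by apply: psdD => //; exact: psdZ.
Qed.

(** Monotonicity of [f] makes the slope of [psi] nonnegative along every ray into the cone;
    self-duality concludes. *)
Lemma G_psd x : psdmx x -> psdmx (G x).
Proof.
move=> xp; apply: psd_of_mxdot; first by case: (psi_gradient xp).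
move=> w wp; apply: slope_le => e e0.
apply: filterS2 (nbhs_right_ge 0) (initial_direction xp (psd_ray xp wp) e0).
move=> s s0; rewrite ler_norml => /andP[_ h].
have sw := psdZ s0 wp.
suff : f (0, x) <= f (0, x + s *: w) by lra.
apply: f_nondecreasing; split => //=; first exact: psdD.
by rewrite /lemx addrC addKr.
Qed.

(** The slope of [psi] along its own gradient [q] is |q|^2 and at most [lip_const f] times |q|. This
    direction is admissible because [q] is positive semi-definite. *)
Lemma G_lip x : psdmx x -> mxnorm2 (G x) <= lip_const f.
Proof.
move=> xp; have qp := G_psd xp.
set q := G x; set n := mxnorm2 q.
have n0 : 0 <= n by rewrite sqrtr_ge0.
have nn : mxdot q q = n ^+ 2 by rewrite sqr_sqrtr // mxdot_ge0.
have L0 := lip_const_ge0 f_lipschitz.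
have h : mxdot q q <= lip_const f * n.
  apply: slope_le => e e0.
  apply: filterS2 (nbhs_right_ge 0) (initial_direction xp (psd_ray xp qp) e0).
  move=> s s0; rewrite ler_norml -/q => /andP[h _].
  have d0 : dom (0 : R, x) by [].
  have d1 : dom (0 : R, x + s *: q).
    by split => //=; apply: psdD => //; exact: psdZ.
  have := lip_constP f_lipschitz d1 d0.
  have -> : pairnorm2 ((0, x + s *: q) - (0, x)) = s * n.
    rewrite /pairnorm2 /pairdot /= subrr mul0r add0r [x + _]addrC addrK.
    rewrite mxdotZr mxdotZl mulrA -expr2 sqrtrM ?sqr_ge0 // sqrtr_sqr.
    by rewrite ger0_norm.
  by move=> /(le_trans (ler_norm _)); lra.
have [->//|np] := eqVneq n 0.
by move: h; rewrite nn expr2 ler_pM2r // lt_def np.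
Qed.

Lemma G_cvg (u : nat -> 'M[R]_K) x : psdmx x -> (forall n, psdmx (u n)) ->
  (forall n i j, `|x i j - u n i j| < n.+1%:R^-1) ->
  mxcvg \oo (fun n => G (u n)) (G x).
Proof.
move=> xp up ux i j; rewrite -entry_mxdot.
under eq_cvg do rewrite -entry_mxdot.
have /subspace_continuousP/(_ x xp) :=
  @G_continuous (delta_mx i j).
move=> c; apply: cvg_comp c => B.
rewrite /within /= => /nbhs_ballP[e /= e0 eB].
apply: filterS (near_infty_natSinv_lt (PosNum e0)) => n /= ne.
apply: eB => //; split => // k l.
exact: lt_trans (ux n k l) ne.
Qed.

(** At a positive definite point the subgradients of a dense sequence converge to the claimed one.
    Boundary points follow by approximation from inside, through continuity of [G]. *)
Lemma initial_subgradient x : psdmx x -> subgradient f (0, x) (H (G x), G x).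
Proof.
have interior z (d : R) : psdmx z -> 0 < d -> lemx d%:M z ->
    subgradient f (0, z) (H (G z), G z).
  move=> zp d0 dz; have zd : dom (0 : R, z) by [].
  have [u [q [ud uy uq qs qH]]] := dense_sequence zd.
  (* At time 0 only directions without time component can be reversed; along these,
     differentiability of [psi] controls the space parts. *)
  have qG : mxcvg \oo (fun n => (q n).2) (G z).
    apply: sym_mxcvg; [by case: (psi_gradient zp)|exact: qs|move=> w ws].
    have wP v : symmx v -> forall e, 0 < e -> \forall s \near 0^'+,
        `|f ((0, z) + s *: (0, v)) - f (0, z) - s * mxdot (G z) v| <= e * s.
      move=> vs e e0.
      have : \forall s \near 0^'+, psdmx (z + s *: v).
        have := dom_direction (v := (0, v)) zd vs d0 dz (or_intror erefl).
        by apply: filterS => s [].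
      move=> /(initial_direction zp)/(_ e e0); apply: filterS => s.
      suff -> : (0, z + s *: v) = (0, z) + s *: (0, v) :> R * 'M[R]_K by [].
      by congr (_, _); rewrite /= scaler0 addr0.
    have := @subgradient_cvg _ _ _ _ _ f u q (0, z) (0, w) (mxdot (G z) w) d
      f_lipschitz zd ud uy uq ws d0 dz (or_intror erefl).
    under eq_cvg do rewrite pairdot_space; apply.
      move=> e e0; apply: filterS (wP w ws e e0) => s.
      by rewrite ler_norml => /andP[_]; lra.
    move=> e e0.
    have Nws : symmx (- w) by rewrite /symmx /= raddfN /= ws.
    apply: filterS (wP (- w) Nws e e0) => s.
    have -> : - (0, w) = (0, - w) :> R * 'M[R]_K by congr (_, _); rewrite oppr0.
    by rewrite mxdotNr ler_norml => /andP[_]; lra.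
  apply: (subgradient_lim f_lipschitz zd ud uy _ uq); split => //=.
  (* The time parts converge because the equation makes them [H] of the space parts. *)
  under eq_cvg do rewrite qH; exact: mxcvg_nonlinearity.
(* The shift makes [u n] positive definite; [n.+2] in place of [n.+1] yields the strict entrywise
   bound asked by [G_cvg]. *)
move=> xp; pose u (n : nat) : 'M[R]_K := (n.+2%:R^-1)%:M + x.
have i0 n : 0 < n.+2%:R^-1 :> R by rewrite invr_gt0.
have up n : psdmx (u n) by apply: psdD => //; exact/psd_scalar/ltW.
have ux n i j : `|x i j - u n i j| < n.+1%:R^-1.
  rewrite !mxE opprD addrCA subrr addr0 normrN.
  apply: (@le_lt_trans _ _ n.+2%:R^-1).
    by rewrite mulrb; case: ifP => _; rewrite ?normr0 ?ger0_norm // ltW.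
  by rewrite ltf_pV2 ?posrE // ltr_nat.
have Gu := G_cvg xp up ux.
apply: (@subgradient_lim R K nat \oo _ f (fun n => (0, u n))
  (fun n => (H (G (u n)), G (u n)))) => //.
- by move=> n; split => //=; exact: up.
- split; first exact: cvg_cst.
  by move=> i j; apply: cvg_inv_succ => n; exact: ltW (ux n i j).
- by split => //=; exact: mxcvg_nonlinearity.
- move=> n; apply: (interior _ _ (up n) (i0 n)).
  by rewrite /lemx /u addrAC subrr add0r.
Qed.

(** Along a minimising sequence the linear growth bounds the trace, hence the entries; a limit along
    an ultrafilter is a minimiser. *)
Lemma coercive_minimum (P : 'M[R]_K) (C d : R) : 0 < d ->
  (forall x, psdmx x -> C + d * \tr x <= psi x - mxdot P x) ->
  exists2 x0, psdmx x0 & forall x, psdmx x ->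
    psi x0 - mxdot P x0 <= psi x - mxdot P x.
Proof.
move=> d0 low; pose Phi x := psi x - mxdot P x.
pose E := [set Phi x | x in @psdmx R K].
have E0 : E !=set0 by exists (Phi 0), 0 => //; exact: psd0.
have EC : has_lbound E.
  exists C => _ [x xp <-]; apply: le_trans (low x xp).
  by rewrite lerDl mulr_ge0 ?psd_trace_ge0 // ltW.
have h (n : nat) : exists x, psdmx x /\ Phi x <= inf E + n.+1%:R^-1.
  have n0 : 0 < n.+1%:R^-1 :> R by rewrite invr_gt0.
  have [_ [x xp <-] xi] := inf_adherent n0 (conj E0 EC).
  by exists x; split => //; exact: ltW.
have [x xP] := choice h.
(* An ultrafilter finer than [\oo] keeps every limit at infinity and makes bounded sequences
   converge. *)
have [U [UU oU]] := ultraFilterLemma (F := \oo) _.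
have xb n i j : `|x n i j| <= (inf E + 1 - C) / d.
  have [xp xi] := xP n.
  apply: le_trans (psd_entry_trace i j xp) _.
  rewrite ler_pdivlMr // mulrC; have := low _ xp.
  have : n.+1%:R^-1 <= 1 :> R by rewrite invf_le1 // ler1n.
  have : psi (x n) - mxdot P (x n) <= inf E + n.+1%:R^-1 by [].
  set I := inf E; set t := _^-1; lra.
have [x0 xx0] := ultra_mxcvg UU xb.
have x0p : psdmx x0 by apply: (mxcvg_psd xx0) => n; have [] := xP n.
exists x0 => // z zp.
(* Written through [f (0, w)], the functional inherits continuity from the Lipschitz bound. *)
have PhiE w : psdmx w -> Phi w = f (0, w) - mxdot P w.
  by move=> wp; rewrite f_psi.
have c1 : f (0, x n) - mxdot P (x n) @[n --> U] --> f (0, x0) - mxdot P x0.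
  apply: cvgB; last by apply: mxcvg_dot => //; exact: mxcvg_cst.
  apply: lipschitz_cvg => //.
    by apply: nearW => n; split => //=; have [] := xP n.
  by split => //; exact: cvg_cst.
have c2 : inf E + n.+1%:R^-1 @[n --> U] --> inf E.
  apply: cvg_trans (_ : inf E + n.+1%:R^-1 @[n --> \oo] --> inf E).
    by move=> B; exact: oU.
  apply: cvg_inv_succ => n; rewrite opprD addrA subrr sub0r normrN ger0_norm //.
apply: (@le_trans _ _ (inf E)); last by apply: ge_inf => //; exists z.
rewrite -/(Phi x0) PhiE //; apply: ler_cvg_to c1 c2 _.
by apply: nearW => n; have [xp] := xP n; rewrite PhiE.
Qed.

(* The linear functional [P] is tilted by [d] to make [psi - P] coercive; at the
   minimizer [x0] of the tilted functional, the gradient [q] of [psi] satisfies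
   [q >= P - d I] with complementary slackness [(q - P + d I) . x0 <= 0]. *)
Lemma approximate_dominating_slope y (b d : R) (P : 'M[R]_K) :
  0 < d -> dom_pos y -> symmx P -> subgradient f y (b, P) ->
  exists q, [/\ psdmx q, mxnorm2 q <= lip_const f, lemx (P - d%:M) q &
                H q * y.1 <= b * y.1 + d * \tr y.2].
Proof.
move=> d0 [y1 y2] Ps yP.
have sub0 x : psdmx x -> f y - b * y.1 + mxdot P (x - y.2) <= psi x.
  move=> xp; have := yP (0, x); rewrite /pairdot /= sub0r mulrN f_psi //.
  by rewrite addrA; apply; split.
have [x xp xmin] : exists2 x, psdmx x & forall z, psdmx z ->
    psi x - mxdot (P - d%:M) x <= psi z - mxdot (P - d%:M) z.
  (* The constant is that of the affine minorant of [psi] in [sub0]; the tilt contributes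
     [d * \tr z]. *)
  apply: (@coercive_minimum _ (f y - b * y.1 - mxdot P y.2) d d0) => z zp.
  have := sub0 z zp.
  rewrite !mxdotDr mxdotDl !mxdotNr mxdotNl mxdot_scalar; lra.
set q := G x; pose r := q - (P - d%:M).
have first_order w :
    (\forall s \near 0^'+, psdmx (x + s *: w)) -> 0 <= mxdot r w.
  move=> wp; apply: slope_le => e e0.
  apply: filterS2 wp (initial_direction xp wp e0) => s sp.
  rewrite ler_norml -/q !f_psi // => /andP[_].
  have := xmin _ sp; rewrite /r mulr0.
  rewrite !mxdotDr !mxdotDl !mxdotNl !mxdotDl !mxdotNl !mxdotZr.
  lra.
have rs : symmx r.
  have [qs _] := G_psd xp.
  by rewrite /symmx /= /r !linearB /= tr_scalar_mx Ps [q^T]qs.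
have rp : psdmx r.
  by apply: psd_of_mxdot => // w wp; apply: first_order; exact: psd_ray.
(* The direction [- x] is admissible too, since [(1 - s) *: x] stays in the cone. *)
have rx : mxdot r x <= 0.
  rewrite -oppr_ge0 -mxdotNr; apply: first_order.
  apply: filterS (near0_unit) => s /andP[_ s1].
  rewrite scalerN -[X in X - _]scale1r -scalerBl.
  by apply: psdZ => //; rewrite subr_ge0.
exists q; split => //; [exact: G_psd|exact: G_lip|].
(* The two subgradient inequalities between [y] and [(0, x)] add up to (H(q) - b) y.1 + (q - P) .
   (y.2 - x) <= 0. As q - P = r - d I, with r . y.2 >= 0, r . x <= 0 and tr x >= 0, the pairing is
   at least - d tr y.2. *)
have h1 := initial_subgradient xp (z := y) (conj (ltW y1) y2).
have h2 := sub0 x xp.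
have h3 := psd_mxdot_ge0 rp y2.
have h4 := psd_trace_ge0 xp.
have h5 : 0 <= d * \tr x by rewrite mulr_ge0 // ltW.
move: h1 h2 h3 rx h5.
rewrite /pairdot /= subr0 f_psi // -/q /r.
rewrite !(mxdotDr, mxdotNr, mxdotDl, mxdotNl, mxdot_scalar).
lra.
Qed.

(** The tilts [n.+1%:R^-1] give slopes bounded by [lip_const f]. All constraints are closed and
    survive in the limit, and division by [y.1 > 0] concludes. *)
Lemma dominating_slope y (b : R) (P : 'M[R]_K) :
  dom_pos y -> symmx P -> subgradient f y (b, P) ->
  exists q, [/\ psdmx q, mxnorm2 q <= lip_const f, lemx P q & H q <= b].
Proof.
move=> yd Ps yP; have [y1 y2] := yd.
have i0 (n : nat) : 0 < n.+1%:R^-1 :> R by rewrite invr_gt0.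
have [q qP] := choice (fun n : nat =>
  approximate_dominating_slope (i0 n) yd Ps yP).
have [U [UU oU]] := ultraFilterLemma (F := \oo) _.
have qb n i j : `|q n i j| <= lip_const f.
  by have [_ qn _ _] := qP n; exact: le_trans (entry_le_norm2 _ _ _) qn.
have [l ql] := ultra_mxcvg UU qb.
have iU : n.+1%:R^-1 @[n --> U] --> (0 : R).
  apply: cvg_trans (_ : n.+1%:R^-1 @[n --> \oo] --> (0 : R)).
    by move=> B; exact: oU.
  by apply: cvg_inv_succ => n; rewrite sub0r normrN ger0_norm // ltW.
exists l; split.
- by apply: (mxcvg_psd ql) => n; have [] := qP n.
- by apply: (mxcvg_norm2_le ql) => n; have [] := qP n.
- apply: (@mxcvg_psd _ _ U _ _ (fun n => q n - (P - (n.+1%:R^-1)%:M))).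
    apply: mxcvgB => // i j; rewrite -[P i j]subr0.
    under eq_cvg do rewrite !mxE.
    apply: cvgB; first exact: cvg_cst.
    by rewrite -(mul0rn _ (i == j)); exact: cvgMn.
  by move=> n; have [] := qP n.
have c1 : H (q n) * y.1 @[n --> U] --> H l * y.1.
  by apply: cvgMr_tmp; exact: mxcvg_nonlinearity.
have c2 : b * y.1 + n.+1%:R^-1 * \tr y.2 @[n --> U] --> b * y.1.
  rewrite -[X in _ --> X]addr0; apply: cvgD; first exact: cvg_cst.
  by rewrite -(mul0r (\tr y.2)); exact: cvgMr_tmp.
rewrite -(ler_pM2r y1); apply: ler_cvg_to c1 c2 _.
by apply: nearW => n; have [] := qP n.
Qed.

End ConvexSelection.

(** * Positivity of space gradients at contact points *)

Section TestFunctions.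
Context {R : realType} {K : nat}.
Implicit Types (f phi : R * 'M[R]_K -> R) (y g : R * 'M[R]_K).

(** Along a direction [w] of the cone [f] does not decrease, so neither does [phi] to first order;
    this holds at boundary points as well. *)
Lemma local_max_psd f phi y g : nondecreasing_dom f -> dom_pos y ->
  has_local_max (f \- phi) y -> gradient_test phi y g -> psdmx g.2.
Proof.
move=> fN [y1 y2] fphi gphi; apply: psd_of_mxdot; first by case: gphi.
move=> w wp; rewrite -pairdot_space; apply: slope_le => e e0.
pose v : R * 'M[R]_K := (0, w).
have yv s : 0 <= s -> dom_pos (y + s *: v) /\ lepair y (y + s *: v).
  move=> s0; have swp := psdZ s0 wp.
  have y1E : (y + s *: v).1 = y.1 by rewrite /= scaler0 addr0.
  split; split; rewrite ?y1E //=; first exact: psdD.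
  by rewrite /lemx addrC addKr.
have dp : \forall s \near 0^'+, dom_pos (y + s *: v).
  by apply: filterS (nbhs_right_ge 0) => s /yv[].
have := gradient_direction (pairdotZr g) gphi dp e0.
apply: filterS3 (nbhs_right_ge 0) (near_direction dp fphi) => s s0 /=.
have [[z1 z2] yz] := yv s s0.
have := fN y (y + s *: v) (conj (ltW y1) y2) (conj (ltW z1) z2) yz.
by rewrite ler_norml => ? ? /andP[_]; lra.
Qed.

(** Positive definiteness allows a step backwards along [w], where [f] is no larger; the subgradient
    inequality then gives [g.2] a nonnegative pairing with [w]. *)
Lemma interior_subgradient_psd f y g : nondecreasing_dom f -> dom_pos y ->
  pdmx y.2 -> symmx g.2 -> subgradient f y g -> psdmx g.2.
Proof.
move=> fN [y1 y2] ypd gs fg; apply: psd_of_mxdot => // w wp.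
have yd : dom y by split => //; exact: ltW.
have [d d0 dy] := pd_lemx_scalar ypd.
pose v : R * 'M[R]_K := (0, - w).
have vs : sympair v.
  by case: wp => ws _; rewrite /sympair /= /symmx /= raddfN /= ws.
have [s [/= s0 sd]] : exists s : R, 0 < s /\ dom (y + s *: v).
  apply: (@filter_ex _ (0 : R)^'+).
  by apply: filterS2 (nbhs_right_gt 0)
    (dom_direction yd vs d0 dy (or_introl y1)).
have le_y : lepair (y + s *: v) y.
  split; first by rewrite /= scaler0 addr0.
  rewrite /lemx /= scalerN opprB addrC subrK.
  by apply: psdZ => //; exact: ltW.
have := fN _ _ sd yd le_y; have := fg _ sd.
rewrite [y + _]addrC addrK pairdotZr pairdot_space mxdotNr mulrN => h1 h2.
by rewrite -(pmulr_rge0 _ s0); lra.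
Qed.

End TestFunctions.

Theorem proposition4p7 (R : realType) (K L p : nat)
  (K_ge1 : (1 <= K)%N) (L_ge1 : (1 <= L)%N) (p_ge1 : (1 <= p)%N)
  (A : 'M[R]_(K ^ p, L)) (f : R * 'M[R]_K -> R) (psi : 'M[R]_K -> R)
  (f_nondecreasing : nondecreasing_dom f)
  (f_lipschitz : lipschitz_dom f)
  (f_convex : convex_dom f)
  (f_gradients : nondecreasing_gradients f)
  (f_psi : initial_condition f psi)
  (psi_C1 : C1_psd psi)
  (f_eq : satisfies_on_dense_subset (nonlinearity A) f) :
  viscosity_solution (nonlinearity A) f /\ initial_condition f psi.
Proof.
split=> //; split; split=> // y phi g yd _ fphi gphi.
  split=> [ypd|_]; last exact: local_max_psd fphi gphi.
  have -> := interior_touched_above p_ge1 f_lipschitz f_convex f_eq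
    yd ypd fphi gphi.
  by rewrite subrr.
have gs : symmx g.2 by case: gphi.
have fg := test_subgradient f_convex yd fphi gphi.
have [G psiG Gc] := psi_C1.
have [q [qp qL gq Hq]] : exists q, [/\ psdmx q, mxnorm2 q <= lip_const f,
    lemx g.2 q & nonlinearity A q <= g.1].
  apply: (dominating_slope p_ge1 f_nondecreasing f_lipschitz f_convex f_psi
    f_eq psiG Gc yd gs).
  by case: g {gphi gs} fg.
split=> [ypd|_].
  (* In the interior [g.2] lies in the cone below [q], so monotonicity of the nonlinearity compares
     the two values. *)
  have gp := interior_subgradient_psd f_nondecreasing yd ypd gs fg.
  by rewrite subr_ge0; apply: le_trans Hq; exact: nonlinearity_mono.
(* Since [g.1%:E] is finite, it suffices that the infimum be at most [g.1], and [q] is a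
   competitor. *)
rewrite sube_ge0; last by rewrite orbT.
apply: (@le_trans _ _ (nonlinearity A q)%:E).
  by apply: ereal_inf_lbound; exists q.
by rewrite lee_fin.
Qed.
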